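(* Let $K$ be a field of characteristic zero. For $k\ge1$ let $b_k:=\dfrac{k\,E_{2k-1}}{(2k)!}\in K$, let $\phi_b$ be the algebra endomorphism of $\mathbf{NSym}$ with $\phi_b(\Psi_k)=b_k\Psi_k$ for all $k\ge 1$, and let $\mathbf{A}_n:=\phi_b(S_n)$. Let $(A_0,A_1,A_2,\dots)$ be the sprout sequence with seed $\sec(\sqrt t\,)$. For a composition $\alpha$ of $n$ let $N(\alpha):=\#\{w\in\mathcal{A}_{2n}:\operatorname{rc}(\hat w)=\alpha\}$. Then for all $n\ge1$, $$(2n)!\,\mathbf{A}_n=\sum_{\alpha\vDash n}N(\alpha)\,\Psi^\alpha=\sum_{\alpha\vDash n}\#\{w\in\mathcal{A}_{2n}:\operatorname{rc}(\hat w)=\alpha\}\,\Psi^\alpha,$$ where the sums are over all compositions $\alpha$ of $n$, and $\chi(\mathbf{A}_n)=A_n$. In particular, the expansion of $(2n)!\,\mathbf{A}_n$ in the basis $\{\Psi^\alpha:\alpha\vDash n\}$ of the degree-$n$ component of $\mathbf{NSym}$ has nonnegative integer coefficients, the coefficient of $\Psi^\alpha$ being the number of alternating permutations of $[2n]$ with record composition $\alpha$.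
   Context: Permutations. $[m]=\{1,\dots,m\}$. A composition of $n$ (written $\alpha\vDash n$) is a finite sequence $\alpha=(\alpha_1,\dots,\alpha_\ell)$ of positive integers with sum $n$. A permutation $w=a_1a_2\dots a_m$ of $[m]$ in one-line notation is alternating if $a_i>a_{i+1}$ for odd $i$ and $a_i<a_{i+1}$ for even $i$ ($1\le i\le m-1$). $\mathcal{A}_{2n}$ is the set of alternating permutations of $[2n]$. The Euler number $E_k$ is the number of alternating permutations of $[k]$, with $E_0=1$; equivalently $\sec t+\tan t=\sum_{k\ge 0}E_k t^k/k!$. For $w=a_1a_2\dots a_{2n}\in\mathcal{A}_{2n}$ let $\hat w=a_1a_3\dots a_{2n-1}$. An index $i\in[n]$ is a record position of $\hat w$ if the $i$-th entry of $\hat w$ is larger than all earlier entries (so $1$ is always a record position). If $r_1=1<r_2<\dots<r_\ell$ are all the record positions of $\hat w$ and $r_{\ell+1}:=n+1$, the record composition is $\operatorname{rc}(\hat w):=(r_2-r_1,\dots,r_{\ell+1}-r_\ell)\vDash n$. Symmetric functions. $\Lambda_K$ is the $K$-algebra of symmetric functions in $x=(x_1,x_2,\dots)$, with complete homogeneous symmetric functions $h_n$. The sprout sequence $(R_0,R_1,\dots)$ with seed a power series $F(t)\in K[[t]]$ with constant term $1$ is defined by $\sum_{n\ge0}R_nt^n=\prod_{i\ge1}F(x_it)$; thus $R_n\in\Lambda_K$ is homogeneous of degree $n$. Here $\sec(\sqrt t\,)$ denotes the power series $\sum_{k\ge0}E_{2k}t^k/(2k)!$. Noncommutative symmetric functions.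 $\mathbf{NSym}=K\langle S_1,S_2,\dots\rangle$ is the free associative $K$-algebra on noncommuting generators $S_k$ of degree $k$, with $S_0:=1$. The noncommutative power sums of the first kind $\Psi_k$ ($k\ge1$) are defined recursively by $nS_n=\sum_{k=1}^{n}S_{n-k}\Psi_k$ for $n\ge1$. For a composition $\alpha=(\alpha_1,\dots,\alpha_\ell)$ put $\Psi^\alpha:=\Psi_{\alpha_1}\cdots\Psi_{\alpha_\ell}$. The $\Psi_k$ freely generate $\mathbf{NSym}$, and $\{\Psi^\alpha:\alpha\vDash n\}$ is a basis of the degree-$n$ component of $\mathbf{NSym}$, so $\phi_b$ exists and is unique. $\chi:\mathbf{NSym}\to\Lambda_K$ is the $K$-algebra homomorphism with $\chi(S_n)=h_n$ for all $n\ge 1$. *)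

(* Defs.v *)
From HB Require Import structures.
From mathcomp Require Import all_boot all_fingroup all_algebra.
From mathcomp Require Import finmap boolp.
From mathcomp Require Import monalg.
From mathcomp Require Import zify.

Set Implicit Arguments.
Unset Strict Implicit.
Unset Printing Implicit Defensive.

Import GRing.Theory.

Local Open Scope ring_scope.

(* a_1 > a_2 < a_3 > ..., with the positions counted from 0. *)
Definition alternating (s : seq nat) : bool :=
  all (fun i => if odd i then (nth 0 s i < nth 0 s i.+1)%N
                else (nth 0 s i.+1 < nth 0 s i)%N)
      (iota 0 (size s).-1).

(* One-line notation; the letters are 0, ..., m-1 instead of 1, ..., m. *)
Definition one_line m (w : 'S_m) : seq nat := [seq val (w i) | i <- enum 'I_m].

Definition alt_perms m : {set 'S_m} := [set w | alternating (one_line w)].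

Definition euler m : nat := #|alt_perms m|.

(* a_1 a_3 a_5 ..., which sit at the even positions when counting from 0. *)
Definition odd_entries (s : seq nat) : seq nat :=
  [seq nth 0%N s i.*2 | i <- iota 0 (uphalf (size s))].

Definition record_positions (s : seq nat) : seq nat :=
  [seq i <- iota 0 (size s) |
     all (fun j => (nth 0 s j < nth 0 s i)%N) (iota 0 i)].

(* The gaps between consecutive record positions, the end of the word being
   added as a last position. *)
Definition record_comp (s : seq nat) : seq nat :=
  let r := rcons (record_positions s) (size s) in
  pairmap (fun i j => (j - i)%N) (head 0%N r) (behead r).

Definition is_composition n (a : seq nat) : bool :=
  all (fun k => (0 < k)%N) a && (sumn a == n).

Record composition n := Composition {
  comp_parts :> seq nat;
  _ : is_composition n comp_parts
}.

HB.instance Definition _ n := [isSub for @comp_parts n].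
HB.instance Definition _ n := [Countable of composition n by <:].

Definition composition_enum n : seq (composition n) :=
  pmap insub
    (undup [seq [seq val i | i <- val s] | s <- enum {bseq n of 'I_n.+1}]).

Lemma composition_enumP n : Finite.axiom (composition_enum n).
Proof.
move=> a; rewrite count_uniq_mem; last first.
  by apply: (pmap_uniq (insubK _)); exact: undup_uniq.
suff -> : a \in composition_enum n by [].
rewrite mem_pmap_sub mem_undup.
case: a => a /= /andP[a0 /eqP an].
have le_an : all (fun k => (k < n.+1)%N) a.
  rewrite -an; elim: a {a0 an} => //= k a /allP IH.
  rewrite ltnS leq_addr /=; apply/allP => x /IH.
  by rewrite !ltnS => /leq_trans; apply; exact: leq_addl.
have size_a : (size (pmap insub a : seq 'I_n.+1) <= n)%N.
  rewrite size_pmap_sub; apply: leq_trans (count_size _ _) _.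
  rewrite -an; elim: a a0 {an le_an} => //= k a IH /andP[k0 /IH].
  by rewrite -add1n => /(leq_add k0).
apply/mapP; exists (Bseq size_a); first by rewrite mem_enum.
rewrite /= (pmap_filter (insubK _)).
by rewrite (@eq_in_filter _ _ predT) ?filter_predT // => k /(allP le_an) ka; rewrite insubT.
Qed.

HB.instance Definition _ n := isFinite.Build (composition n) (@composition_enumP n).

Definition num_alt_record n (a : seq nat) : nat :=
  #|[set w in alt_perms (2 * n) | record_comp (odd_entries (one_line w)) == a]|.

(* K[[x_0, x_1, ...]]; the monomials have finite support. *)
Record mpseries (K : Type) := MPSeries { mpcoef :> {cmonom nat} -> K }.

HB.instance Definition _ (K : Type) := gen_eqMixin (mpseries K).
HB.instance Definition _ (K : Type) := gen_choiceMixin (mpseries K).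

Section MPSeries.
Variable K : fieldType.
Implicit Types (f g h : mpseries K) (m : {cmonom nat}).

Lemma mpsP f g : (forall m, f m = g m) -> f = g.
Proof. by case: f g => [f] [g] /= /funext ->. Qed.

Definition mono_of_ffun m (e : {ffun finsupp m -> 'I_(mdeg m).+1}) :
    {cmonom nat} :=
  mkcmonom [fsfun i : finsupp m => (e i : nat) | 0%N].

(* A finite set of monomials that contains all the divisors of m. *)
Definition mbox m : {fset {cmonom nat}} :=
  [fset mono_of_ffun e | e in {: {ffun finsupp m -> 'I_(mdeg m).+1}}]%fset.

Lemma mboxP m a b : mmul a b = m -> a \in mbox m.
Proof.
move=> <-{m}; set m := mmul a b.
have le_m i : (a i < (mdeg m).+1)%N.
  rewrite ltnS mdegM (leq_trans _ (leq_addr _ _)) //.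
  case: (finsuppP a i) => // ia.
  by rewrite mdegE (big_fsetD1 i) //= leq_addr.
apply/imfsetP; exists [ffun i => Ordinal (le_m (val i))] => //=.
apply/eqP/cmP => i; rewrite cmE fsfun_ffun.
case: insubP => [j _ <-|] /=; first by rewrite ffunE.
by rewrite mdomD in_fsetU negb_or => /andP[/fsfun_dflt].
Qed.

Definition mps_zero := MPSeries (fun _ => 0 : K).
Definition mps_one := MPSeries (fun m => (m == mone)%:R : K).
Definition mps_opp f := MPSeries (fun m => - f m).
Definition mps_add f g := MPSeries (fun m => f m + g m).
Definition mps_mul f g := MPSeries (fun m =>
  \sum_(a <- mbox m) \sum_(b <- mbox m | mmul a b == m) f a * g b).
Definition mps_scale (c : K) f := MPSeries (fun m => c * f m).


Fact mps_addA : associative mps_add.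
Proof. by move=> f g h; apply: mpsP => m /=; rewrite addrA. Qed.

Fact mps_addC : commutative mps_add.
Proof. by move=> f g; apply: mpsP => m /=; rewrite addrC. Qed.

Fact mps_add0 : left_id mps_zero mps_add.
Proof. by move=> f; apply: mpsP => m /=; rewrite add0r. Qed.

Fact mps_addN : left_inverse mps_zero mps_opp mps_add.
Proof. by move=> f; apply: mpsP => m /=; rewrite addNr. Qed.

HB.instance Definition _ := GRing.isZmodule.Build (mpseries K)
  mps_addA mps_addC mps_add0 mps_addN.

Lemma mps_mulEw (D : {fset {cmonom nat}}) f g m :
  (forall a b, mmul a b = m -> a \in D) ->
  mps_mul f g m = \sum_(a <- D) \sum_(b <- D | mmul a b == m) f a * g b.
Proof.
move=> Dm.
pose E := (D `|` mbox m)%fset.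
have widen (B : {fset {cmonom nat}}) : (B `<=` E)%fset ->
    (forall a b, mmul a b = m -> a \in B) ->
  \sum_(a <- B) \sum_(b <- B | mmul a b == m) f a * g b =
  \sum_(a <- E) \sum_(b <- E | mmul a b == m) f a * g b.
  move=> BE Bm; rewrite [LHS](big_fset_incl _ BE) /=.
    apply: eq_bigr => a _; rewrite big_mkcond [RHS]big_mkcond /=.
    apply: (big_fset_incl _ BE) => b _ bB.
    by case: eqP => // /esym ab; rewrite (Bm b a) // mulmC in bB.
  move=> a _ aB; rewrite big1_seq // => b /andP[/eqP ab _].
  by rewrite (Bm a b) in aB.
by rewrite [RHS](widen D) ?fsubsetUl // -(widen (mbox m)) ?fsubsetUr //; exact: mboxP.
Qed.

(* Associativity is transferred from the polynomial ring by truncation. *)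
Let trunc (D : {fset {cmonom nat}}) f : {malg K[{cmonom nat}]} :=
  [malg a in D => f a].

Let truncM (D : {fset {cmonom nat}}) f g m :
  (forall a b, mmul a b = m -> a \in D) ->
  mps_mul f g m = (trunc D f * trunc D g)@_m.
Proof.
move=> Dm; rewrite (mps_mulEw _ _ Dm).
rewrite (@malgMEw _ _ D D) ?raddf_sum /=; last first.
- by apply/fsubsetP => a; rewrite -mcoeff_neq0 mcoeffE; case: ifP => //; rewrite eqxx.
- by apply/fsubsetP => a; rewrite -mcoeff_neq0 mcoeffE; case: ifP => //; rewrite eqxx.
apply: eq_big_seq => a aD; rewrite raddf_sum /= big_mkcond /=.
apply: eq_big_seq => b bD; rewrite mcoeffU !mcoeffE aD bD.
by case: ifP => _; rewrite ?mulr1n ?mulr0n.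
Qed.

Fact mps_mulC : commutative mps_mul.
Proof.
move=> f g; apply: mpsP => m.
by rewrite !(truncM _ _ (@mboxP m)) mulrC.
Qed.

Fact mps_mulA : associative mps_mul.
Proof.
move=> f g h; apply: mpsP => m; pose D := mbox m.
have Dm a b : mmul a b = m -> a \in D by exact: mboxP.
have DmM a b : mmul a b = m -> forall x y, mmul x y = a -> x \in D.
  by move=> abm x y xya; apply: (Dm _ (mmul y b)); rewrite mulmA xya.
have truncMM u v w : mps_mul (mps_mul u v) w m
    = (trunc D u * trunc D v * trunc D w)@_m.
  rewrite (mps_mulEw _ _ Dm).
  rewrite (@malgMEw _ _ (D `|` msupp (trunc D u * trunc D v))%fset D);
    last 2 first.
  - by rewrite fsubsetUr.
  - by apply/fsubsetP => a; rewrite -mcoeff_neq0 mcoeffE; case: ifP => //; rewrite eqxx.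
  rewrite raddf_sum /=.
  have DE : (D `<=` D `|` msupp (trunc D u * trunc D v))%fset by rewrite fsubsetUl.
  rewrite [LHS](big_fset_incl _ DE) /=; last first.
    move=> a _ aD; rewrite big1_seq // => b /andP[/eqP ab _].
    by rewrite (Dm a b) in aD.
  apply: eq_bigr => a _; rewrite raddf_sum /= big_mkcond /=.
  apply: eq_big_seq => b bD; rewrite mcoeffU mcoeffE bD.
  case: eqP => [abm|_]; rewrite ?mulr1n ?mulr0n //.
  by congr (_ * _); apply: truncM; exact: DmM abm.
rewrite [in LHS]mps_mulC.
rewrite [LHS](truncMM g h f).
rewrite [RHS](truncMM f g h).
by rewrite [X in X@_m = _]mulrC mulrA.
Qed.

Fact mps_mul1 : left_id mps_one mps_mul.
Proof.
move=> f; apply: mpsP => m /=.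
have m1 : mone \in mbox m by apply: (@mboxP _ _ m); rewrite mul1m.
have mm : m \in mbox m by apply: (@mboxP _ _ mone); rewrite mulm1.
rewrite (big_fsetD1 mone) //= [X in _ + X]big1_seq ?addr0; last first.
  move=> a /andP[_]; rewrite in_fsetD1 => /andP[/negPf a1 _].
  by rewrite big1 //= => b _; rewrite a1 mul0r.
rewrite big_mkcond (big_fsetD1 m) //= mul1m !eqxx mul1r.
rewrite big1_seq /= ?addr0 // => b; rewrite in_fsetD1 mul1m => /andP[/negPf bm _].
by rewrite bm.
Qed.

Fact mps_mulDl : left_distributive mps_mul mps_add.
Proof.
move=> f g h; apply: mpsP => m /=; rewrite -big_split /=.
apply: eq_bigr => a _; rewrite -big_split /=.
by apply: eq_bigr => b _; rewrite mulrDl.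
Qed.

Fact mps_1neq0 : mps_one != 0.
Proof.
apply/eqP => /(congr1 (fun f => mpcoef f mone)) /= /eqP.
by rewrite eqxx oner_eq0.
Qed.

HB.instance Definition _ := GRing.Zmodule_isComNzRing.Build (mpseries K)
  mps_mulA mps_mulC mps_mul1 mps_mulDl mps_1neq0.

Fact mps_scaleA c d f : mps_scale c (mps_scale d f) = mps_scale (c * d) f.
Proof. by apply: mpsP => m /=; rewrite mulrA. Qed.

Fact mps_scale1 : left_id 1 (mps_scale).
Proof. by move=> f; apply: mpsP => m /=; rewrite mul1r. Qed.

Fact mps_scaleDr : right_distributive (mps_scale) +%R.
Proof. by move=> c f g; apply: mpsP => m /=; rewrite mulrDr. Qed.

Fact mps_scaleDl f : {morph (mps_scale)^~ f : c d / c + d}.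
Proof. by move=> c d; apply: mpsP => m /=; rewrite mulrDl. Qed.

HB.instance Definition _ := GRing.Zmodule_isLmodule.Build K (mpseries K)
  mps_scaleA mps_scale1 mps_scaleDr mps_scaleDl.

Fact mps_scaleAl c f g : c *: (f * g) = c *: f * g.
Proof.
apply: mpsP => m /=; rewrite big_distrr /=; apply: eq_bigr => a _.
by rewrite big_distrr /=; apply: eq_bigr => b _; rewrite mulrA.
Qed.

HB.instance Definition _ := GRing.Lmodule_isLalgebra.Build K (mpseries K)
  mps_scaleAl.
HB.instance Definition _ := GRing.Lalgebra_isComAlgebra.Build K (mpseries K).

Lemma mps0E m : (0 : mpseries K) m = 0. Proof. by []. Qed.
Lemma mps1E m : (1 : mpseries K) m = (m == mone)%:R. Proof. by []. Qed.
Lemma mpsDE f g m : (f + g) m = f m + g m. Proof. by []. Qed.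
Lemma mpsZE c f m : (c *: f) m = c * f m. Proof. by []. Qed.
Lemma mpsME f g m : (f * g) m =
  \sum_(a <- mbox m) \sum_(b <- mbox m | mmul a b == m) f a * g b.
Proof. by []. Qed.
Lemma mpsMEw (D : {fset {cmonom nat}}) f g m :
  (forall a b, mmul a b = m -> a \in D) ->
  (f * g) m = \sum_(a <- D) \sum_(b <- D | mmul a b == m) f a * g b.
Proof. exact: mps_mulEw. Qed.

Definition mpvar (i : nat) : mpseries K := MPSeries (fun m => (m == ucm i)%:R).

(* Bounded degree, and invariance under every permutation of the variables. *)
Definition is_symmetric_function f : Prop :=
  (exists d, forall m, (d < mdeg m)%N -> f m = 0) /\
  (forall s : nat -> nat, bijective s ->
   forall m m', (forall i, m' i = m (s i)) -> f m' = f m).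

Definition symfun_pred : pred (mpseries K) := fun f => `[< is_symmetric_function f >].

Fact symfun_subalg : subalg_closed symfun_pred.
Proof.
split=> [|c f g|f g].
- apply/asboolP; split.
    exists 0%N => m; rewrite mps1E lt0n mdeg_eq0.
    by case: eqP.
  move=> s [t st ts] m m' mm'; rewrite !mps1E; congr (_%:R); congr nat_of_bool.
  apply/eqP/eqP => H; apply/eqP/cmP => i; rewrite cm1.
    by rewrite -(ts i) -mm' H cm1.
  by rewrite mm' H cm1.
- move=> /asboolP[[df fd] fs] /asboolP[[dg gd] gs]; apply/asboolP; split.
    exists (maxn df dg) => m; rewrite gtn_max mpsDE mpsZE => /andP[/fd-> /gd->].
    by rewrite mulr0 addr0.
  by move=> s bs m m' mm'; rewrite !mpsDE !mpsZE (fs s bs m m') // (gs s bs m m').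
move=> /asboolP[[df fd] fs] /asboolP[[dg gd] gs]; apply/asboolP; split.
  exists (df + dg)%N => m dm; rewrite mpsME big1 // => a _; rewrite big1 // => b /eqP ab.
  have [/fd->|da] := ltnP df (mdeg a); first by rewrite mul0r.
  have [/gd->|db] := ltnP dg (mdeg b); first by rewrite mulr0.
  by move: dm; rewrite -ab mdegM ltnNge leq_add.
move=> s bs m m' mm'; have [t st ts] := bs.
pose pm (u v : nat -> nat) (a : {cmonom nat}) : {cmonom nat} :=
  mkcmonom [fsfun i in [fset v j | j in finsupp a]%fset => a (u i) | 0%N].
have pmE u v (uv : cancel u v) a i : pm u v a i = a (u i).
  rewrite cmE fsfun_fun; case: imfsetP => // nai.
  apply/esym/eqP; rewrite cmE_eq0; apply/negP => aui.
  by case: nai; exists (u i) => //=; rewrite uv.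
pose P := pm s t; pose Q := pm t s.
have PE a i : P a i = a (s i) by exact: pmE.
have QE a i : Q a i = a (t i) by exact: pmE.
have PK : cancel P Q by move=> a; apply/eqP/cmP => i; rewrite QE PE ts.
have QK : cancel Q P by move=> a; apply/eqP/cmP => i; rewrite PE QE st.
have PM a b : P (mmul a b) = mmul (P a) (P b).
  by apply/eqP/cmP => i; rewrite !cmM !PE cmM.
have Pm : m' = P m by apply/eqP/cmP => i; rewrite PE mm'.
rewrite [RHS]mpsME [LHS](@mpsMEw (P @` mbox m)%fset); last first.
  move=> a b; rewrite Pm => ab; rewrite -(QK a); apply: in_imfset => /=.
  apply: (@mboxP _ _ (Q b)); apply: (can_inj PK).
  by rewrite PM !QK.
have Pinj : {in mbox m &, injective P} by move=> a b _ _; exact: (can_inj PK).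
rewrite big_imfset //=; apply: eq_bigr => a _.
rewrite big_mkcond big_imfset //= [RHS]big_mkcond /=; apply: eq_bigr => b _.
rewrite Pm -PM (inj_eq (can_inj PK)).
by rewrite (fs s bs a (P a)) ?(gs s bs b (P b)) //; exact: PE.
Qed.

End MPSeries.

HB.instance Definition _ (K : fieldType) :=
  GRing.isSubalgClosed.Build K (mpseries K) (@symfun_pred K) (@symfun_subalg K).

Record symfun (K : fieldType) := SymFun {
  symfun_series :> mpseries K;
  _ : symfun_series \in @symfun_pred K
}.

HB.instance Definition _ (K : fieldType) := [isSub for @symfun_series K].
HB.instance Definition _ (K : fieldType) := [Choice of symfun K by <:].
HB.instance Definition _ (K : fieldType) := [SubChoice_isSubAlgebra of symfun K by <:].
HB.instance Definition _ (K : fieldType) := [SubNzRing_isSubComNzRing of symfun K by <:].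

(* The monoid algebra of the free monoid on nat, that is, the free associative
   algebra on a sequence of generators. *)
Definition NSym (K : fieldType) := {malg K[{fmonom nat}]}.

HB.instance Definition _ (K : fieldType) := GRing.Lalgebra.on (NSym K).

Fact nsym_scaleAr (K : fieldType) (c : K) (x y : NSym K) : c *: (x * y) = x * (c *: y).
Proof.
apply/malgP => k; apply: etrans (mcoeffZ c (x * y) k) _.
apply: etrans (congr1 ( *%R c) (mcoeffMl x y k)) _; apply/esym.
apply: etrans (mcoeffMlw k (fsubset_refl _) (msuppZ_le c y)) _.
rewrite big_distrr; apply: eq_bigr => i _; rewrite big_distrr /=.
by apply: eq_bigr => j _; rewrite mcoeffZ mulrCA mulrnAr.
Qed.

HB.instance Definition _ (K : fieldType) :=
  GRing.Lalgebra_isAlgebra.Build K (NSym K) (@nsym_scaleAr K).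

(* Stated for an arbitrary algebra only to keep unification fast. *)
Lemma lrmorphism_scaling (K : fieldType) (B : algType K)
    (phi : {lrmorphism B -> B}) (b : nat -> K) (S p u : nat -> B) :
  (forall n, (0 < n)%N ->
     n%:R *: S n = \sum_(1 <= k < n.+1) S (n - k)%N * p k) ->
  (forall n, (0 < n)%N ->
     n%:R *: u n = \sum_(1 <= k < n.+1) u (n - k)%N * (b k *: p k)) ->
  (forall n, phi (S n) = u n) -> u 0%N = 1 ->
  forall k, (0 < k)%N -> phi (p k) = b k *: p k.
Proof.
move=> p_rec u_rec phiS u0 n; have [N] := ubnP n.
elim: N n => // N IH n; rewrite ltnS => nN n0.
have := congr1 phi (p_rec n n0).
rewrite linearZ_LR /= phiS u_rec // raddf_sum /= !big_nat_recr //=.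
rewrite rmorphM /= subnn phiS u0 !mul1r.
rewrite [in RHS](eq_big_nat _ _ (F2 := fun k => u (n - k)%N * (b k *: p k))).
  by move/addrI => ->.
move=> k /andP[k0 kn]; rewrite rmorphM /= phiS IH //.
exact: leq_trans kn nN.
Qed.

Section NSymTheory.
Variable K : fieldType.

(* The letter k of the free monoid stands for the generator S_{k+1}. *)
Definition nsymS n : NSym K := if n is k.+1 then << fmu k >> else 1.

(* [:: Psi_1; ...; Psi_n], by Psi_n = n S_n - sum_{1 <= k < n} S_{n-k} Psi_k. *)
Fixpoint psi_upto n : seq (NSym K) :=
  if n is m.+1 then
    let s := psi_upto m in
    rcons s (m.+1%:R *: nsymS m.+1 - \sum_(k < m) nsymS (m - k) * s`_k)
  else [::].

(* The value at n = 0 is irrelevant. *)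
Definition psi n : NSym K := (psi_upto n)`_n.-1.

Lemma size_psi_upto n : size (psi_upto n) = n.
Proof. by elim: n => //= n IH; rewrite size_rcons IH. Qed.

Lemma nth_psi_upto n k : (k < n)%N -> (psi_upto n)`_k = psi k.+1.
Proof.
elim: n => // n IH; rewrite ltnS leq_eqVlt => /predU1P[->|kn] //.
by rewrite [LHS]/= nth_rcons size_psi_upto kn IH.
Qed.

Lemma psi_rec n : (0 < n)%N ->
  n%:R *: nsymS n = \sum_(1 <= k < n.+1) nsymS (n - k) * psi k.
Proof.
case: n => // n _; rewrite big_nat_recr //= subnn mul1r.
rewrite [psi n.+1]/psi /= nth_rcons size_psi_upto ltnn eqxx.
rewrite big_add1 big_mkord /=.
have aux (V : zmodType) (x y z : V) : y = z -> x = y + (x - z).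
  by move=> ->; rewrite addrC subrK.
by apply: aux; apply: eq_bigr => k _; rewrite subSS nth_psi_upto.
Qed.

Definition psi_word (a : seq nat) : NSym K := \prod_(k <- a) psi k.

Section Lift.
Variables (B : algType K) (u : nat -> B).

Definition word_eval (w : {fmonom nat}) : B := \prod_(k <- (w : seq nat)) u k.+1.

Fact word_eval_morph : mmorphism word_eval.
Proof.
split=> [x y|]; first by rewrite /word_eval fmM big_cat.
by rewrite /word_eval fm1 big_nil.
Qed.

HB.instance Definition _ :=
  isMultiplicative.Build _ _ word_eval word_eval_morph.

Definition nsym_lift : NSym K -> B := mmap (in_alg B) word_eval.

HB.instance Definition _ := GRing.Additive.copy nsym_lift (mmap (in_alg B) word_eval).

Fact nsym_lift_monoid : GRing.monoid_morphism nsym_lift.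
Proof.
suff [] : multiplicative (mmap (in_alg B) word_eval) by split.
by apply: commr_mmap_is_multiplicative => g m m'; rewrite /GRing.comm mulr_algl mulr_algr.
Qed.

HB.instance Definition _ :=
  GRing.isMonoidMorphism.Build (NSym K) B nsym_lift nsym_lift_monoid.

Fact nsym_lift_scalable : scalable nsym_lift.
Proof. by move=> c x; rewrite /nsym_lift mmapZ mulr_algl. Qed.

HB.instance Definition _ :=
  GRing.isScalable.Build K (NSym K) B *:%R nsym_lift nsym_lift_scalable.

Lemma nsym_liftS n : (0 < n)%N -> nsym_lift (nsymS n) = u n.
Proof.
case: n => // n _; rewrite /nsym_lift mmapU /= scale1r mul1r.
by rewrite /word_eval fmU big_seq1.
Qed.

End Lift.

Lemma exists_nsym_lift (B : algType K) (u : nat -> B) :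
  exists phi : {lrmorphism NSym K -> B},
    forall n, (0 < n)%N -> phi (nsymS n) = u n.
Proof. by exists (nsym_lift u); exact: nsym_liftS. Qed.

Let exists_scaling (b : nat -> K) (p : nat -> NSym K) :
  (forall n, (0 < n)%N ->
     n%:R *: nsymS n = \sum_(1 <= k < n.+1) nsymS (n - k) * p k) ->
  [pchar K] =i pred0 ->
  exists phi : {lrmorphism NSym K -> NSym K},
    forall k, (0 < k)%N -> phi (p k) = b k *: p k.
Proof.
move=> p_rec /pcharf0P K0.
pose fix upto n : seq (NSym K) := if n is m.+1 then
    let s := upto m in
    rcons s (m.+1%:R^-1 *: \sum_(1 <= k < m.+2) (1 :: s)`_(m.+1 - k) * (b k *: p k))
  else [::].
pose u n := (1 :: upto n)`_n.
have size_upto n : size (upto n) = n.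
  by elim: n => //= n IH; rewrite size_rcons IH.
have uptoE n k : (k <= n)%N -> (1 :: upto n)`_k = u k.
  elim: n => [|n IH]; first by rewrite leqn0 => /eqP->.
  rewrite leq_eqVlt => /predU1P[->//|]; rewrite ltnS => kn.
  rewrite -IH // [LHS]/= -[1 :: rcons _ _]/(rcons (1 :: upto n) _).
  by rewrite nth_rcons /= size_upto ltnS kn.
have u_last n : u n.+1 = n.+1%:R^-1 *:
    \sum_(1 <= k < n.+2) (1 :: upto n)`_(n.+1 - k) * (b k *: p k).
  by rewrite /u /= nth_rcons size_upto ltnn eqxx.
have u0 : u 0%N = 1 by [].
clearbody u; have u_rec n : (0 < n)%N ->
    n%:R *: u n = \sum_(1 <= k < n.+1) u (n - k)%N * (b k *: p k).
  case: n => // n _; rewrite u_last scalerA mulfV ?K0 // scale1r.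
  apply: eq_big_nat => k /andP[k0 _].
  by rewrite uptoE // leq_subLR -[n.+1]add1n leq_add2r.
clear uptoE u_last size_upto upto.
have [phi phiS] := exists_nsym_lift u.
have liftS k : phi (nsymS k) = u k.
  by case: k => [|k]; [rewrite rmorph1 u0 | rewrite phiS].
by exists phi; exact: (@lrmorphism_scaling K (NSym K) phi b nsymS p u p_rec u_rec liftS u0).
Qed.

Lemma exists_psi_scaling (b : nat -> K) : [pchar K] =i pred0 ->
  exists phi : {lrmorphism NSym K -> NSym K},
    forall k, (0 < k)%N -> phi (psi k) = b k *: psi k.
Proof. exact: exists_scaling psi_rec. Qed.

End NSymTheory.

Section SymFunctions.
Variable K : fieldType.

(* The sum of all the monomials of degree n. *)
Definition hsym_series n : mpseries K := MPSeries (fun m => (mdeg m == n)%:R).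

Lemma mdeg_perm (s : nat -> nat) (m m' : {cmonom nat}) :
  bijective s -> (forall i, m' i = m (s i)) -> mdeg m' = mdeg m.
Proof.
move=> [t st ts] mm'.
have -> : mdeg m = (\sum_(i <- [fset s j | j in finsupp m']%fset) m i)%N.
  rewrite (@mdegEw _ m [fset s j | j in finsupp m']%fset) //.
  apply/fsubsetP => i im; apply/imfsetP; exists (t i); rewrite /= ?ts //.
  by rewrite -cmE_neq0 mm' ts cmE_neq0.
rewrite big_imfset /=; last by move=> a b _ _; exact: (can_inj st).
by rewrite mdegE; apply: eq_bigr => i _.
Qed.

Fact hsym_subproof n : hsym_series n \in @symfun_pred K.
Proof.
apply/asboolP; split; first by exists n => m /=; case: ltngtP.
by move=> s bs m m' mm' /=; rewrite (mdeg_perm bs mm').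
Qed.

Definition hsym n : symfun K := SymFun (hsym_subproof n).

(* The coefficient of t^n in F(x_0 t) ... F(x_{N-1} t); the terms of F of
   degree above n do not contribute to it. *)
Definition sprout_partial (F : nat -> K) (n N : nat) : mpseries K :=
  (\prod_(i < N) \poly_(k < n.+1) (F k *: mpvar K i ^+ k))`_n.

(* sum_n R_n t^n is the infinite product of the F(x_i t), the limit being
   taken coefficient by coefficient. *)
Definition sprout_sequence (F : nat -> K) (R : nat -> symfun K) : Prop :=
  forall (n : nat) (m : {cmonom nat}),
  exists N0, forall N, (N0 <= N)%N -> R n m = sprout_partial F n N m.

Definition sprout_series (F : nat -> K) n : mpseries K := MPSeries (fun m =>
  if mdeg m == n then \prod_(i <- finsupp m) F (m i) else 0).

Fact sprout_subproof F n : sprout_series F n \in @symfun_pred K.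
Proof.
apply/asboolP; split; first by exists n => m /=; case: ltngtP.
move=> s bs m m' mm' /=; rewrite (mdeg_perm bs mm'); case: ifP => // _.
have [t st ts] := bs.
have -> : finsupp m = [fset s j | j in finsupp m']%fset.
  apply/fsetP => i; apply/idP/imfsetP => [im|[j /= jm ->]].
    exists (t i); rewrite /= ?ts //.
    by rewrite -cmE_neq0 mm' ts cmE_neq0.
  by rewrite -cmE_neq0 -mm' cmE_neq0.
rewrite big_imfset /=; last by move=> a b _ _; exact: (can_inj st).
by apply: eq_bigr => i _; rewrite mm'.
Qed.

Definition sprout F n : symfun K := SymFun (sprout_subproof F n).

Let mono (u : {cmonom nat}) : mpseries K := MPSeries (fun m => (m == u)%:R).

Let mulr_monoE f u m :
  (f * mono u) m = if mmul (divcm m u) u == m then f (divcm m u) else 0.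
Proof.
have cancel_u a b : mmul a u = m -> mmul a b = m -> b = u.
  move=> <- /eqP/cmP E; apply/eqP/cmP => i; have := E i.
  by rewrite !cmM => /addnI.
rewrite mpsME; case: eqP => [dm|nd].
  have dbox := mboxP dm.
  have ubox : u \in mbox m by apply: (@mboxP _ _ (divcm m u)); rewrite mulmC.
  rewrite (big_fsetD1 (divcm m u)) //= [X in _ + X]big1_seq ?addr0 /=.
    rewrite big_mkcond (big_fsetD1 u) //= dm !eqxx mulr1.
    rewrite big1_seq ?addr0 //= => b; rewrite in_fsetD1 => /andP[/negPf bu _].
    by rewrite bu mulr0 if_same.
  move=> a; rewrite in_fsetD1 => /andP[/eqP ad _].
  rewrite big1 // => b /eqP ab; case: eqP; rewrite ?mulr0 // => bu; case: ad.
  apply/eqP/cmP => i; move/eqP/cmP: ab => /(_ i); rewrite cmM divcmE bu => <-.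
  by rewrite addnK.
rewrite big1 // => a _; rewrite big1 // => b /eqP ab /=.
case: eqP; rewrite ?mulr0 // => bu; case: nd; apply/eqP/cmP => i.
move/eqP/cmP: ab => /(_ i); rewrite !cmM divcmE bu => <-.
by rewrite addnK.
Qed.

Let upow (i k : nat) : {cmonom nat} := mkcmonom [fsfun j in [fset i]%fset => k | 0%N].

Let upowE i k j : upow i k j = if j == i then k else 0%N.
Proof. by rewrite cmE fsfun_fun in_fset1. Qed.

Let mpvarX i k : mpvar K i ^+ k = mono (upow i k).
Proof.
elim: k => [|k IH].
  have -> : upow i 0 = mone by apply/eqP/cmP => j; rewrite cm1 upowE if_same.
  by rewrite expr0; apply: mpsP.
rewrite exprSr IH; apply: mpsP => m.
rewrite [LHS](mulr_monoE (mono (upow i k)) (ucm i) m) /=.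
have upowS : upow i k.+1 = mmul (upow i k) (ucm i).
  by apply/eqP/cmP => j; rewrite cmM !upowE; case: eqP; lia.
case: eqP => [dm|nd].
  have -> // : (divcm m (ucm i) == upow i k) = (m == upow i k.+1).
  rewrite upowS; apply/eqP/eqP => [<-|->]; first by rewrite dm.
  by apply/eqP/cmP => j; rewrite divcmE cmM addnK.
case: eqP => // E; case: nd; rewrite E upowS.
by apply/eqP/cmP => j; rewrite cmM divcmE cmM addnK.
Qed.

Let shiftE f c i k m : (f * (c *: mpvar K i ^+ k)) m =
  if mmul (divcm m (upow i k)) (upow i k) == m
  then c * f (divcm m (upow i k)) else 0.
Proof.
rewrite mpvarX -scalerAr.
apply: etrans (congr1 ( *%R c) (mulr_monoE f (upow i k) m)) _.
by case: ifP; rewrite ?mulr0.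
Qed.

Lemma sprout_partialE F n N d m : (d <= n)%N ->
  ((\prod_(i < N) \poly_(k < n.+1) (F k *: mpvar K i ^+ k))`_d : mpseries K) m =
  if (mdeg m == d) && [forall i : finsupp m, val i < N]%N
  then \prod_(i < N) F (m i) else 0.
Proof.
elim: N d m => [|N IH] d m dn.
  rewrite !big_ord0 coef1.
  have -> : [forall i : finsupp m, val i < 0]%N = (mdeg m == 0)%N.
    rewrite mdeg_eq0; apply/forallP/eqP => [H|-> [i /= im]].
      apply/eqP/cmP => i; rewrite cm1; apply/eqP; rewrite cmE_eq0.
      by apply/negP => im; have := H [` im]%fset.
    by have := im; rewrite mdom1 in_fset0.
  case: d dn => [|d] _; rewrite ?mps0E ?mps1E /=.
    by rewrite -mdeg_eq0; case: eqP.
  by case: eqP => //= ->; case: eqP.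
rewrite big_ord_recr /= coefMr.
have sumE (I : Type) (r : seq I) (G : I -> mpseries K) :
    (\sum_(i <- r) G i : mpseries K) m = \sum_(i <- r) (G i) m.
  by apply: (big_morph (fun f : mpseries K => f m)) => // f g; rewrite mpsDE.
rewrite sumE.
have term (k : 'I_d.+1) :
    ((\prod_(i < N) \poly_(k < n.+1) (F k *: mpvar K i ^+ k))`_(d - k)
      * (\poly_(k < n.+1) (F k *: mpvar K N ^+ k))`_k : mpseries K) m =
    if (k == m N :> nat) && (mdeg m == d) && [forall i : finsupp m, val i < N.+1]%N
    then \prod_(i < N.+1) F (m i) else 0.
  have kn : (k < n.+1)%N by have := ltn_ord k; lia.
  rewrite coef_poly kn; apply: etrans (shiftE _ _ _ _ _) _.
  rewrite (IH _ _ (leq_trans (leq_subr _ _) dn)).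
  set q := divcm m _.
  have qE j : q j = (m j - (if j == N then (k : nat) else 0))%N by rewrite divcmE upowE.
  have upowdeg : mdeg (upow N k) = k.
    rewrite (@mdegEw _ _ [fset N]%fset) ?big_seq_fset1 ?upowE ?eqxx //.
    by apply/fsubsetP => j; rewrite -cmE_neq0 upowE in_fset1; case: (j == N).
  case: (@eqP _ (mmul q (upow N k)) m) => [qm|nqm]; last first.
    case: eqP => //= kN; case: nqm.
    by apply/eqP/cmP => j; rewrite cmM qE upowE; case: eqP => [->|]; rewrite -?kN; lia.
  have degE : mdeg m = (mdeg q + k)%N by rewrite -qm mdegM upowdeg.
  have kd : (k <= d)%N by rewrite -ltnS.
  have -> : (mdeg q == d - k)%N = (mdeg m == d) by rewrite degE; apply/eqP/eqP; lia.
  have kmN : (k <= m N)%N by rewrite -qm cmM upowE eqxx leq_addl.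
  have -> : [forall i : finsupp q, val i < N]%N =
      (k == m N :> nat) && [forall i : finsupp m, val i < N.+1]%N.
    apply/forallP/andP => [H|[/eqP kN /forallP H] [i /= iq]].
      have HN : q N = 0%N.
        by apply/eqP; rewrite cmE_eq0; apply/negP => iq; have := H [` iq]%fset; rewrite /= ltnn.
      split; first by move: HN; rewrite qE eqxx => HN; apply/eqP; lia.
      apply/forallP => -[i /= im]; rewrite ltnS leq_eqVlt; case: eqVneq => //= iN.
      have iq : i \in finsupp q.
        by rewrite -cmE_neq0 qE (negPf iN) subn0 cmE_neq0.
      exact: (H [` iq]%fset).
    have iN : i != N.
      by apply: contraTneq iq => ->; rewrite -cmE_eq0 qE eqxx kN subnn.
    have im : i \in finsupp m.
      by move: iq; rewrite -!cmE_neq0 qE (negPf iN) subn0.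
    by have := H [` im]%fset; rewrite /= ltnS leq_eqVlt (negPf iN).
  rewrite -andbA [in RHS]andbCA; case: ifP => /= [/andP[_ /andP[/eqP kN _]]|]; last by rewrite mulr0.
  rewrite big_ord_recr /= mulrC kN; congr (_ * _).
  by apply: eq_bigr => i _; rewrite qE (ltn_eqF (ltn_ord i)) subn0.
rewrite (eq_bigr _ (fun k _ => term k)).
case: (boolP ((mdeg m == d) && _)) => [/andP[md mN]|H]; last first.
  by rewrite big1 // => k _; rewrite -andbA (negPf H) andbF.
have mNd : (m N < d.+1)%N.
  rewrite ltnS -(eqP md); case: (finsuppP m N) => // Nm.
  by rewrite mdegE (big_fsetD1 N) //= leq_addr.
rewrite (bigD1 (Ordinal mNd)) //= eqxx md mN /= [X in _ + X]big1 ?addr0 // => k.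
by rewrite -val_eqE /= => /negPf ->.
Qed.

(* A seed with constant term 1 has a sprout sequence. *)
Lemma sproutP F : F 0%N = 1 -> sprout_sequence F (sprout F).
Proof.
move=> F0 n m; exists (\max_(i <- finsupp m) i.+1)%N => N HN.
have mN i : i \in finsupp m -> (i < N)%N.
  move=> im; apply: leq_trans HN.
  by rewrite (big_fsetD1 i) //= leq_maxl.
rewrite /sprout_partial sprout_partialE //=.
have -> : [forall i : finsupp m, val i < N]%N by apply/forallP => -[i /= /mN].
rewrite andbT; case: ifP => // _.
rewrite -(big_mkord predT (fun i => F (m i))) [RHS](bigID (fun i => i \in finsupp m)) /=.
rewrite [X in _ * X]big1 ?mulr1; last by move=> i /fsfun_dflt ->.
rewrite -[RHS]big_filter; apply: perm_big; apply: uniq_perm.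
- exact: fset_uniq.
- by rewrite filter_uniq ?iota_uniq.
move=> i; rewrite mem_filter mem_index_iota /=.
by case: (boolP (i \in _)) => //= /mN ->.
Qed.

Lemma exists_nsym_comm_image :
  exists chi : {lrmorphism NSym K -> symfun K},
    forall n, (0 < n)%N -> chi (nsymS K n) = hsym n.
Proof. by exists (nsym_lift hsym); exact: nsym_liftS. Qed.

(* E_{2k} / (2k)! is the coefficient of t^k in sec(sqrt t). *)
Definition sec_sqrt (k : nat) : K := (euler (2 * k))%:R / ((2 * k)`!)%:R.

Lemma sec_sqrt0 : sec_sqrt 0 = 1.
Proof.
suff E0 : euler 0 = 1%N by rewrite /sec_sqrt muln0 E0 divr1.
rewrite /euler (_ : alt_perms 0 = [set: 'S_0]) ?cardsT ?card_Sn //.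
have e0 : enum 'I_0 = [::] by apply: size0nil; rewrite size_enum_ord.
by apply/setP => w; rewrite !inE /one_line e0.
Qed.

Definition coef_b (k : nat) : K :=
  (k * euler (2 * k).-1)%:R / ((2 * k)`!)%:R.

End SymFunctions.

(* Main.v *)
From HB Require Import structures.
Require Import Defs.
From mathcomp Require Import all_boot all_fingroup all_algebra.
From mathcomp Require Import finmap monalg zify ring.

Set Implicit Arguments.
Unset Strict Implicit.
Unset Printing Implicit Defensive.

Import GRing.Theory.
Local Open Scope ring_scope.

(** Write [u_n] for the image of [S_n] under [phi]. Applying [phi] to the
    recursion that defines the [Psi_k] gives
      [n u_n = sum_(1 <= k <= n) b_k u_(n-k) Psi_k],
    which determines the [u_n] in characteristic zero. Multiplied by [(2n)!] and
    divided by [n], it says that the coefficient [f] of [Psi^a] in [(2n)! u_n]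
    satisfies
      [f (a, k) = C(2n-1, 2k-1) * E_(2k-1) * f (a)]
    for a composition [(a, k)] of [n] with last part [k].

    The numbers of alternating permutations of [2n] letters with given record
    composition satisfy the same recursion ([num_alt_record_rcons]). The largest
    letter of an alternating word is a peak, so it sits among the odd entries
    and is their last record. Since the last part of the record composition is
    [k], exactly [2k-1] letters follow it; they can be any [2k-1] of the
    other letters, arranged in an alternating word that starts with an ascent
    ([E_(2k-1)] ways), and the [2(n-k)] letters in front of it form an alternating
    word with record composition [a].

    For the commutative image, Newton's identities [n h_n = sum h_(n-k) p_k]
    show that [chi] sends [Psi_k] to the power sum [p_k], so that the images of the
    [u_n] satisfy [n v_n = sum b_k v_(n-k) p_k]. Logarithmic differentiation of
    the product of the [F(x_i t)] shows that a sprout sequence satisfies this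
    recursion when [t F'(t) / F(t) = sum b_k t^k] ([sprout_newton]). For
    [F = sec(sqrt t)] this is a convolution of Euler numbers
    ([euler_even_rec]), obtained by summing the recursion for alternating
    permutations over all compositions. The same lemma with [F = 1/(1 - t)]
    gives Newton's identities.

    The coefficients are unique because an endomorphism of [NSym] sends each
    [Psi_k] to the free generator [S_k], hence the [Psi^a] to distinct words
    ([psi_word_inj]). *)

(** * Alternating words around their largest letter *)

Local Open Scope nat_scope.

(** The two parities of alternation have to be handled together: the part
    of an alternating word that follows its maximum starts with an ascent. *)
Fixpoint zigzag (up : bool) (s : seq nat) : bool :=
  if s is x :: s' then
    (if s' is y :: _ then if up then x < y else y < x else true)
      && zigzag (~~ up) s'
  else true.

Lemma alternatingE s : alternating s = zigzag false s.
Proof.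
rewrite /alternating.
suff gen up t : all (fun i => if odd i (+) up then nth 0 t i < nth 0 t i.+1
    else nth 0 t i.+1 < nth 0 t i) (iota 0 (size t).-1) = zigzag up t.
  by rewrite -gen; apply: eq_all => i; rewrite addbF.
elim: t up => // x [|y t] IH up //; rewrite [RHS]/= -[X in _ && X]IH.
rewrite [LHS]/= -/(size (y :: t)).-1 -[1]addn0 iotaDl all_map.
by congr (_ && _); apply: eq_all => i /=; rewrite addNb addbN.
Qed.

Definition below m (s : seq nat) := all (fun x => x < m) s.

(** The step into a maximum is an ascent and the step out of it a descent; this
    fixes the parity of the number of letters before it and imposes nothing
    else at the two junctions. The case left out is that of a word beginning
    with its maximum and required to go up. *)
Lemma zigzag_cat_max m up s t : below m s -> below m t -> s != [::] \/ ~~ up ->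
  zigzag up (s ++ m :: t) = [&& odd (size s) == up, zigzag up s & zigzag true t].
Proof.
move=> + tm; elim: s up => [|x s IH] up.
  move=> _ [//|/negPf->] /=.
  by case: t tm => //= y t /andP[-> _].
case: s IH => [|y s] IH /=.
  rewrite andbT => xm _; case: up => /=; last by rewrite ltnNge ltnW.
  by rewrite xm; case: t tm {IH} => //= y t /andP[-> _].
move=> /andP[xm sm] _; have := IH (~~ up) sm (or_introl isT) => /= ->.
by rewrite eqb_negLR andbCA -!andbA !negbK.
Qed.

(** Properties that only see the relative order of the letters; the number of
    arrangements of an alphabet with such a property depends only on the size
    of the alphabet. *)
Definition order_invariant (P : pred (seq nat)) :=
  forall g s, {in s &, {mono g : x y / x < y}} -> P (map g s) = P s.

Lemma zigzag_invariant up : order_invariant (zigzag up).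
Proof.
move=> g s; elim: s up => // x s IH up gs /=; rewrite IH; last first.
  by apply: sub_in2 gs => y ys; rewrite inE ys orbT.
case: s {IH} gs => // y s gs /=.
by rewrite !gs ?inE ?eqxx ?orbT.
Qed.

Lemma zigzag_flip g s up : {in s &, forall x y, (g x < g y) = (y < x)} ->
  zigzag up (map g s) = zigzag (~~ up) s.
Proof.
elim: s up => // x s IH up gs /=; rewrite IH; last first.
  by apply: sub_in2 gs => y ys; rewrite inE ys orbT.
case: s {IH} gs => // y s gs /=.
by rewrite !gs ?inE ?eqxx ?orbT //; case: up.
Qed.

Lemma size_odd_entries s : size (odd_entries s) = uphalf (size s).
Proof. by rewrite size_map size_iota. Qed.

Lemma odd_entries_sub s : {subset odd_entries s <= s}.
Proof.
move=> x /mapP[i]; rewrite mem_iota /= add0n => iu ->; apply: mem_nth.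
by rewrite gtn_uphalf_double in iu.
Qed.

Lemma odd_entries_cat s t : ~~ odd (size s) ->
  odd_entries (s ++ t) = odd_entries s ++ odd_entries t.
Proof.
move=> /even_halfK s2; rewrite /odd_entries.
have -> : uphalf (size (s ++ t)) = (size s)./2 + uphalf (size t).
  by rewrite size_cat; lia.
have -> : uphalf (size s) = (size s)./2 by lia.
rewrite iotaD map_cat add0n -[X in iota X (uphalf _)]addn0 iotaDl -map_comp; congr (_ ++ _).
  apply/eq_in_map => i; rewrite mem_iota => /= ile.
  by rewrite nth_cat ifT //; lia.
apply/eq_in_map => i _ /=; rewrite nth_cat ifF; last by lia.
by congr nth; lia.
Qed.

Lemma odd_entries_cons x s : exists t,
  [/\ odd_entries (x :: s) = x :: t, size t = (size s)./2 & {subset t <= s}].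
Proof.
exists [seq nth 0 s i.*2.+1 | i <- iota 0 (size s)./2].
rewrite size_map size_iota; split=> //.
  rewrite /odd_entries [uphalf _]/= /= -[1]addn0 iotaDl -map_comp.
  by congr (_ :: _); apply/eq_in_map.
move=> _ /mapP[i + ->]; rewrite mem_iota => /andP[_ ilt].
by rewrite mem_nth // -gtn_half_double.
Qed.

Lemma odd_entries_map g s : odd_entries (map g s) = map g (odd_entries s).
Proof.
rewrite /odd_entries size_map -map_comp; apply/eq_in_map => i.
rewrite mem_iota /= add0n => iu; apply: nth_map.
by rewrite gtn_uphalf_double in iu.
Qed.

Lemma record_comp_invariant a : order_invariant (fun s => record_comp s == a).
Proof.
move=> g s gs; congr (_ == _); rewrite /record_comp size_map.
suff -> : record_positions (map g s) = record_positions s by [].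
rewrite /record_positions size_map; apply: eq_in_filter => i.
rewrite mem_iota /= add0n => ilt; apply: eq_in_all => j.
rewrite mem_iota /= add0n => jlt; have jlt' := ltn_trans jlt ilt.
by rewrite !(nth_map 0) // gs ?mem_nth.
Qed.

Lemma record_positions_cat_max m s t : below m s -> below m t ->
  record_positions (s ++ m :: t) = rcons (record_positions s) (size s).
Proof.
move=> /allP sm /allP tm; rewrite /record_positions size_cat iotaD filter_cat /= add0n.
rewrite -cats1; congr (_ ++ _).
  apply: eq_in_filter => i; rewrite mem_iota /= add0n => ilt.
  apply: eq_in_all => j; rewrite mem_iota /= add0n => jlt.
  by rewrite !nth_cat ilt (ltn_trans jlt).
rewrite ifT; last first.
  apply/allP => j; rewrite mem_iota /= add0n => jlt.
  by rewrite !nth_cat jlt ltnn subnn /= sm ?mem_nth.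
congr (_ :: _); apply/eqP; rewrite -size_eq0 size_filter eqn0Ngt -has_count -all_predC.
apply/allP => i; rewrite mem_iota => /andP[ilo ihi] /=; apply/allPn; exists (size s).
  by rewrite mem_iota; lia.
have i_s : (i < size s) = false by lia.
rewrite -leqNgt !nth_cat ltnn subnn i_s /= ltnW //.
have [j -> jt] : exists2 j, i = size s + j.+1 & j < size t.
  by exists (i - (size s).+1); lia.
by rewrite addKn /= tm // mem_nth.
Qed.

Lemma pairmap_rcons (T U : Type) (f : T -> T -> U) x s y :
  pairmap f x (rcons s y) = rcons (pairmap f x s) (f (last x s) y).
Proof. by elim: s x => //= z s IH x; rewrite IH. Qed.

(** The maximum is the last record, whatever comes after it. *)
Lemma record_comp_cat_max m s t : below m s -> below m t ->
  record_comp (s ++ m :: t) = rcons (record_comp s) (size t).+1.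
Proof.
move=> sm tm; rewrite /record_comp record_positions_cat_max // size_cat /=.
rewrite [X in behead X]headI [X in head _ X]headI headI /=.
case: (record_positions s) => [|r rs] /=.
  by rewrite addKn.
by rewrite pairmap_rcons last_rcons addKn.
Qed.

(** The first letter is always a record, so the gaps between consecutive records
    telescope to the whole length. *)
Lemma record_comp_composition s : is_composition (size s) (record_comp s).
Proof.
have gaps x r : path ltn x r ->
    let d := pairmap (fun i j => j - i) x r in
    all (fun k => 0 < k) d /\ sumn d + x = last x r.
  elim: r x => //= y r IH x /andP[xy /IH[-> IHs]]; rewrite subn_gt0 xy; split=> //.
  by rewrite -IHs; lia.
rewrite /is_composition /record_comp; case: s => [//|x s].
have r0 : exists r, record_positions (x :: s) = 0 :: r by eexists.
have : sorted ltn (rcons (record_positions (x :: s)) (size (x :: s))).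
  case: r0 => r r0; rewrite r0 [sorted _ _]rcons_path; apply/andP; split.
    suff : sorted ltn (record_positions (x :: s)) by rewrite r0.
    by apply: sorted_filter; [exact: ltn_trans | exact: iota_ltn_sorted].
  have : last 0 r \in record_positions (x :: s) by rewrite r0 mem_last.
  by rewrite mem_filter mem_iota => /and3P[].
case: r0 => r ->; rewrite /= => /gaps[-> ].
by rewrite last_rcons addn0 => /eqP.
Qed.

(** * Counting words over an alphabet *)

Lemma perm_permutations_map (g : nat -> nat) L : {in L &, injective g} -> uniq L ->
  perm_eq (permutations (map g L)) (map (map g) (permutations L)).
Proof.
move=> gI uL; rewrite perm_sym.
have uM : uniq (map (map g) (permutations L)).
  rewrite map_inj_in_uniq ?permutations_uniq // => s t.
  rewrite !mem_permutations => /perm_mem sL /perm_mem tL.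
  apply: (inj_in_map gI); by apply/allP => x; rewrite ?sL ?tL.
have subM : {subset map (map g) (permutations L) <= permutations (map g L)}.
  move=> _ /mapP[s + ->]; rewrite !mem_permutations; exact: perm_map.
apply: uniq_perm => //; first exact: permutations_uniq.
apply: (uniq_min_size uM subM _).2.
by rewrite size_map !size_permutations ?size_map // map_inj_in_uniq.
Qed.

Lemma perm_one_line m :
  perm_eq [seq one_line w | w <- enum 'S_m] (permutations (iota 0 m)).
Proof.
have uM : uniq [seq one_line w | w <- enum 'S_m].
  rewrite map_inj_uniq ?enum_uniq // => v w /eq_in_map vw.
  by apply/permP => i; apply: val_inj; apply: vw; rewrite mem_enum.
have subM : {subset [seq one_line w | w <- enum 'S_m] <= permutations (iota 0 m)}.
  move=> _ /mapP[w _ ->]; rewrite mem_permutations; apply: uniq_perm.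
  - by rewrite map_inj_uniq ?enum_uniq // => i j /val_inj/perm_inj.
  - exact: iota_uniq.
  move=> x; rewrite mem_iota add0n /=; apply/mapP/idP.
    by case=> i _ ->; exact: ltn_ord.
  by move=> xm; exists (w^-1%g (Ordinal xm)); rewrite ?mem_enum // permKV.
apply: uniq_perm => //; first exact: permutations_uniq.
apply: (uniq_min_size uM subM _).2.
by rewrite size_map size_permutations ?iota_uniq // size_iota -cardE card_Sn.
Qed.

Lemma card_one_line m (P : pred (seq nat)) :
  #|[set w : 'S_m | P (one_line w)]| = count P (permutations (iota 0 m)).
Proof.
rewrite -(seq.permP (perm_one_line m)) count_map cardE size_filter enumT.
by apply: eq_count => w; exact: in_set.
Qed.

Lemma count_relabel (P : pred (seq nat)) L : order_invariant P -> sorted ltn L ->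
  count P (permutations L) = count P (permutations (iota 0 (size L))).
Proof.
move=> invP sL; have uL := sorted_uniq ltn_trans ltnn sL.
have gmono : {in iota 0 (size L) &, {mono nth 0 L : x y / x < y}}.
  move=> i j; rewrite !mem_iota /= !add0n => iL jL.
  have H := sorted_ltn_nth ltn_trans 0 sL.
  case: (ltngtP i j) => [ij|ji|->]; last exact: ltnn.
    by apply: H.
  by apply/negbTE; rewrite -leqNgt ltnW //; apply: H.
rewrite -[in LHS](mkseq_nth 0 L) /mkseq.
rewrite (seq.permP (perm_permutations_map _ _)) ?iota_uniq //.
  rewrite count_map; apply: eq_in_count => s; rewrite mem_permutations => /perm_mem sI.
  by apply: invP => x y; rewrite !sI; exact: gmono.
move=> i j; rewrite !mem_iota /= !add0n => iL jL /eqP.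
by rewrite nth_uniq // => /eqP.
Qed.

(** Reversing the order of the letters exchanges ascents and descents. *)
Lemma count_zigzag_up m :
  count (zigzag true) (permutations (iota 0 m)) = euler m.
Proof.
rewrite /euler /alt_perms card_one_line.
pose g x := m.-1 - x.
have gI : {in iota 0 m &, injective g}.
  by move=> x y; rewrite !mem_iota /g; lia.
have gL : perm_eq (map g (iota 0 m)) (iota 0 m).
  apply: uniq_perm; rewrite ?iota_uniq ?map_inj_in_uniq ?iota_uniq // => x.
  rewrite mem_iota; apply/mapP/idP => [[y]|xm].
    by rewrite mem_iota /g; lia.
  by exists (g x); rewrite ?mem_iota /g; lia.
rewrite -(seq.permP (perm_permutations gL)) (seq.permP (perm_permutations_map gI _)) ?iota_uniq //.
rewrite count_map; apply: eq_in_count => s; rewrite mem_permutations => /perm_mem sI.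
rewrite /= alternatingE zigzag_flip // => x y; rewrite !sI !mem_iota /g; lia.
Qed.

Definition letters m (A : {set 'I_m}) : seq nat := map val (enum A).

Lemma size_letters m (A : {set 'I_m}) : size (letters A) = #|A|.
Proof. by rewrite size_map cardE. Qed.

Lemma letters_sorted m (A : {set 'I_m}) : sorted ltn (letters A).
Proof.
rewrite /letters sorted_map /enum_mem -enumT.
apply: sorted_filter; first by move=> i j k; exact: ltn_trans.
by rewrite -sorted_map val_enum_ord iota_ltn_sorted.
Qed.

Lemma mem_letters m (A : {set 'I_m}) (i : 'I_m) : (val i \in letters A) = (i \in A).
Proof. by rewrite mem_map ?mem_enum //; exact: val_inj. Qed.

Lemma below_letters m (A : {set 'I_m}) s : perm_eq s (letters A) -> below m s.
Proof.
by move=> /perm_mem sA; apply/allP => x; rewrite sA => /mapP[i _ ->] /=.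
Qed.

(** A permutation is determined by the set [A] of letters in front of its maximum
    and the arrangements of [A] and of its complement. *)
Lemma perm_split_max m :
  perm_eq (permutations (iota 0 m.+1))
    [seq st.1 ++ m :: st.2 | A <- enum {set 'I_m},
       st <- [seq (s, t) | s <- permutations (letters A),
                           t <- permutations (letters (~: A))]].
Proof.
have letU (A : {set 'I_m}) : perm_eq (letters A ++ m :: letters (~: A)) (iota 0 m.+1).
  rewrite -[m.+1]addn1 iotaD /= add0n -[m :: letters _]cat1s catA.
  rewrite perm_catAC perm_cat2r.
  rewrite -map_cat -[iota 0 m]val_enum_ord; apply: perm_map.
  apply: uniq_perm; rewrite ?enum_uniq //.
    rewrite cat_uniq !enum_uniq andbT; apply/hasPn => i.
    by rewrite !mem_enum inE.
  by move=> i; rewrite mem_cat !mem_enum inE; case: (i \in A).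
have below_s s (A : {set 'I_m}) : perm_eq s (letters A) -> m \notin s.
  by move=> /below_letters/allP sm; apply/negP => /sm; rewrite ltnn.
apply: uniq_perm; first exact: permutations_uniq.
  apply: allpairs_uniq_dep; first exact: enum_uniq.
    by move=> A _; apply: allpairs_uniq; rewrite ?permutations_uniq // => -[] ? ? [].
  move=> p q /allpairsPdep[A [st [_ /allpairsP[[s t] /= [sA tA ->]] ->]]].
  move=> /allpairsPdep[A' [st' [_ /allpairsP[[s' t'] /= [sA' tA' ->]] ->]]] /=.
  rewrite !mem_permutations in sA tA sA' tA' *.
  move=> E; have size_st : size s = size s'.
    have /(congr1 (index m)) := E.
    rewrite !index_cat (negPf (below_s _ _ sA)) (negPf (below_s _ _ sA')) /=.
    by rewrite eqxx !addn0.
  have := congr1 (take (size s)) E; rewrite take_size_cat // size_st take_size_cat //.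
  have := congr1 (drop (size s).+1) E.
  rewrite -!cat_rcons drop_size_cat ?size_rcons // size_st drop_size_cat ?size_rcons //.
  move=> -> ss; subst s'; suff -> : A = A' by [].
  by apply/setP => i; rewrite -!mem_letters -(perm_mem sA) (perm_mem sA').
move=> w; rewrite mem_permutations; apply/idP/allpairsPdep => [wI|]; last first.
  move=> [A [st [_ /allpairsP[[s t] /= [sA tA ->]] ->]]] /=.
  rewrite !mem_permutations in sA tA.
  apply: perm_trans (letU A); apply: perm_cat => //.
  by rewrite perm_cons.
have uw : uniq w by rewrite (perm_uniq wI) iota_uniq.
have mw : m \in w by rewrite (perm_mem wI) mem_iota /= leqnn.
case/splitPr: mw wI uw => s t wI uw.
pose A := [set i : 'I_m | val i \in s].
move: uw; rewrite -cat1s uniq_catCA cat1s cons_uniq => /andP[mst ust].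
have us : uniq s by move: ust; rewrite cat_uniq => /andP[].
have wm x : (x \in s ++ t) = (x < m).
  have := perm_mem wI x; rewrite mem_cat inE mem_iota /= add0n ltnS mem_cat.
  case: (eqVneq x m) => [->|xm /= ->]; last by rewrite ltn_neqAle xm.
  by rewrite -mem_cat (negPf mst) ltnn.
have sA : perm_eq s (letters A).
  apply: uniq_perm => //; first by rewrite (sorted_uniq ltn_trans ltnn (letters_sorted A)).
  move=> x; apply/idP/mapP => [xs|[i + ->]]; last by rewrite mem_enum inE.
  have xm : x < m by rewrite -wm mem_cat xs.
  by exists (Ordinal xm); rewrite // mem_enum inE.
exists A, (s, t); split=> //; first by rewrite mem_enum.
apply/allpairsP; exists (s, t); rewrite /= !mem_permutations sA; split=> //.
rewrite -(perm_cons m) -(perm_cat2l s); apply: perm_trans wI _.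
rewrite perm_sym; apply: perm_trans (letU A).
by rewrite perm_cat2r.
Qed.

(** When the property [Q] of the front part forces its length [j], only the
    sets of [j] letters contribute, each by the same amount. *)
Lemma count_split_max m j (P Q R : pred (seq nat)) :
    order_invariant Q -> order_invariant R ->
    (forall s, Q s -> size s = j) ->
    (forall s t, below m s -> below m t -> size s + size t = m ->
       P (s ++ m :: t) = Q s && R t) ->
  count P (permutations (iota 0 m.+1)) =
  'C(m, j) * count Q (permutations (iota 0 j))
           * count R (permutations (iota 0 (m - j))).
Proof.
move=> invQ invR sizeQ PQR.
rewrite (seq.permP (perm_split_max m)) -sum1_count big_mkcond big_allpairs_dep big_enum /=.
transitivity (\sum_(A : {set 'I_m} | #|A| == j)
   count Q (permutations (iota 0 j)) * count R (permutations (iota 0 (m - j)))).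
  rewrite [RHS]big_mkcond; apply: eq_bigr => A _; rewrite big_allpairs.
  have szC : size (letters (~: A)) = m - #|A|.
    by rewrite size_letters cardsCs setCK card_ord.
  transitivity (count Q (permutations (letters A)) * count R (permutations (letters (~: A)))).
    rewrite -[count Q _]sum1_count -[count R _]sum1_count big_distrl /= [RHS]big_mkcond.
    apply: eq_big_seq => s; rewrite mem_permutations => sA; rewrite mul1n.
    rewrite [in RHS]big_mkcond -[RHS](fun_if (fun f => f)).
    transitivity (\sum_(t <- permutations (letters (~: A))) if Q s then if R t then 1 else 0 else 0).
      apply: eq_big_seq => t; rewrite mem_permutations => tA /=.
      rewrite PQR ?(below_letters sA) ?(below_letters tA) //; first by case: (Q s).
      rewrite (perm_size sA) (perm_size tA) szC size_letters subnKC //.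
      by rewrite -[m in X in _ <= X]card_ord max_card.
    by case: (Q s) => //; rewrite big1.
  case: eqP => [Aj|Aj].
    rewrite (count_relabel invQ (letters_sorted A)).
    by rewrite (count_relabel invR (letters_sorted _)) szC size_letters Aj.
  rewrite (_ : count Q _ = 0) ?mul0n //; apply/eqP; rewrite eqn0Ngt -has_count.
  apply/hasPn => s; rewrite mem_permutations => /perm_size sA; apply/negP => /sizeQ sj.
  by case: Aj; rewrite -sj sA size_letters.
rewrite sum_nat_const -mulnA; congr (_ * _).
by rewrite -[in RHS](card_ord m) -card_draws cardsE.
Qed.

Lemma num_alt_recordE n a : num_alt_record n a =
  count (fun s => alternating s && (record_comp (odd_entries s) == a))
        (permutations (iota 0 (2 * n))).
Proof.
rewrite -card_one_line; congr #|pred_of_set _|; apply/setP => w.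
by rewrite !inE.
Qed.

(** The combinatorial recursion: split at the largest letter. *)
Lemma num_alt_record_rcons n a k : 0 < k <= n ->
  num_alt_record n (rcons a k) =
  'C((2 * n).-1, (2 * k).-1) * euler (2 * k).-1 * num_alt_record (n - k) a.
Proof.
move=> /andP[k0 kn].
pose Q s := [&& size s == 2 * (n - k), alternating s & record_comp (odd_entries s) == a].
have invQ : order_invariant Q.
  move=> g s gs; rewrite /Q size_map !alternatingE zigzag_invariant // odd_entries_map.
  rewrite record_comp_invariant //; apply: sub_in2 gs; exact: odd_entries_sub.
have sizeQ s : Q s -> size s = 2 * (n - k) by case/and3P => /eqP.
rewrite num_alt_recordE (_ : 2 * n = (2 * n).-1.+1); last by lia.
rewrite (count_split_max invQ (zigzag_invariant true) sizeQ) => [|s t sm tm size_st].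
  rewrite count_zigzag_up num_alt_recordE mulnAC /=.
  rewrite (_ : (2 * n).-1 - 2 * (n - k) = (2 * k).-1); last by lia.
  (* The sets of letters before and after the maximum are complementary. *)
  rewrite -[in 'C(_, 2 * (n - k))]bin_sub; last by lia.
  rewrite (_ : (2 * n).-1 - 2 * (n - k) = (2 * k).-1); last by lia.
  congr (_ * _); apply: eq_in_count => s; rewrite mem_permutations => /perm_size.
  by rewrite size_iota /Q => ->; rewrite eqxx.
rewrite !alternatingE zigzag_cat_max ?orbT //; last by right.
case: (boolP (odd (size s))) => s2 /=.
  apply/esym/negbTE; apply: contraL s2 => /andP[/sizeQ -> _].
  by rewrite mul2n odd_double.
rewrite /Q alternatingE.
rewrite odd_entries_cat //.
have [t' [-> size_t' t't]] := odd_entries_cons (2 * n).-1 t.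
have subbelow (u v : seq nat) : {subset u <= v} -> below (2 * n).-1 v -> below (2 * n).-1 u.
  by move=> uv /allP vm; apply/allP => x /uv/vm.
rewrite record_comp_cat_max ?eqseq_rcons; last 2 first.
- apply: subbelow sm; exact: odd_entries_sub.
- exact: subbelow tm.
have -> : ((size t').+1 == k) = (size s == 2 * (n - k)) by apply/eqP/eqP; lia.
by case: (zigzag false s) (zigzag true t) (_ == a) (size s == _) => [] [] [] [].
Qed.

Lemma sum_num_alt_record n : \sum_(a : composition n) num_alt_record n a = euler (2 * n).
Proof.
pose rc (w : 'S_(2 * n)) := record_comp (odd_entries (one_line w)).
transitivity (\sum_(a : composition n) \sum_(w in alt_perms (2 * n)) (rc w == a)).
  apply: eq_bigr => a _; rewrite /num_alt_record -sum1_card big_mkcond [RHS]big_mkcond.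
  by apply: eq_bigr => w _; rewrite in_set; case: (w \in _) => //=; case: eqP.
rewrite exchange_big /euler -sum1_card; apply: eq_bigr => w _.
have rcw : is_composition n (rc w).
  have := record_comp_composition (odd_entries (one_line w)).
  suff -> : size (odd_entries (one_line w)) = n by [].
  by rewrite size_odd_entries size_map size_enum_ord; lia.
rewrite (bigD1 (Composition rcw)) //= eqxx big1 // => a.
by rewrite -val_eqE /= eq_sym => /negPf->.
Qed.

(** * Sums over compositions *)

Lemma mem_val_enum_composition n s :
  (s \in [seq val a | a <- enum {: composition n}]) = is_composition n s.
Proof.
apply/mapP/idP => [[a _ ->]|sn]; first exact: (valP a).
by exists (Composition sn); rewrite ?mem_enum.
Qed.

Lemma perm_composition_last n : 0 < n ->
  perm_eq [seq val a | a <- enum {: composition n}]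
    [seq rcons a k | k <- iota 1 n,
                     a <- [seq val a | a <- enum {: composition (n - k)}]].
Proof.
move=> n0; apply: uniq_perm.
- by rewrite map_inj_uniq ?enum_uniq //; exact: val_inj.
- apply: allpairs_uniq_dep; first exact: iota_uniq.
    by move=> k _; rewrite map_inj_uniq ?enum_uniq //; exact: val_inj.
  by move=> [k a] [l b] _ _ /= /eqP; rewrite eqseq_rcons => /andP[/eqP-> /eqP->].
move=> s; rewrite mem_val_enum_composition; apply/idP/allpairsPdep.
  case/lastP: s => [/eqP sn|a k]; first by rewrite -sn in n0.
  rewrite /is_composition all_rcons sumn_rcons => /andP[/andP[k0 a0] /eqP ak].
  exists k, a; rewrite mem_iota mem_val_enum_composition /is_composition a0; split=> //.
    by lia.
  by apply/eqP; lia.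
move=> [k [a [+ + ->]]]; rewrite mem_iota mem_val_enum_composition.
move=> /andP[k0 kn] /andP[a0 /eqP an]; rewrite /is_composition all_rcons k0 a0 /=.
by rewrite sumn_rcons; apply/eqP; lia.
Qed.

(** Both the recursion defining the [Psi_k] and the removal of the largest letter
    peel off the last part of a composition. *)
Lemma sum_composition_last (V : nmodType) n (G : seq nat -> V) : 0 < n ->
  (\sum_(a : composition n) G a =
   \sum_(1 <= k < n.+1) \sum_(a : composition (n - k)%N) G (rcons a k))%R.
Proof.
move=> n0; transitivity (\sum_(s <- [seq val a | a <- enum {: composition n}]) G s)%R.
  by rewrite big_map big_enum.
rewrite (perm_big _ (perm_composition_last n0)) big_allpairs_dep.
rewrite /index_iota subn1; apply: eq_bigr => k _.
by rewrite big_map big_enum.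
Qed.

(** Sum of the recursion for [num_alt_record] over all record compositions. *)
Lemma euler_even_rec n : 0 < n ->
  euler (2 * n) = \sum_(1 <= k < n.+1)
    'C((2 * n).-1, (2 * k).-1) * euler (2 * k).-1 * euler (2 * (n - k)).
Proof.
move=> n0; rewrite -sum_num_alt_record (sum_composition_last _ n0).
apply: eq_big_nat => k /andP[k0 kn]; rewrite -sum_num_alt_record big_distrr /=.
by apply: eq_bigr => a _; rewrite num_alt_record_rcons ?k0.
Qed.

Lemma composition0 (a : composition 0) : a = [::] :> seq nat.
Proof. by case: a => -[|[|k] a] //=; rewrite /is_composition andbC. Qed.

Lemma num_alt_record0 : num_alt_record 0 [::] = 1.
Proof. by rewrite num_alt_recordE. Qed.

Local Open Scope ring_scope.

(** * Newton recursions *)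

Section NewtonPairs.
Variable K : fieldType.

(** In generating functions, [t S'(t) = S(t) p(t)], with the factors in this
    order since [B] need not be commutative. The instances are [S_n] with
    [Psi_k], [h_n] with [p_k], and the images of these pairs. *)
Definition newton_pair (B : algType K) (S p : nat -> B) : Prop :=
  S 0%N = 1 /\
  forall n, (0 < n)%N -> n%:R *: S n = \sum_(1 <= k < n.+1) S (n - k)%N * p k.

Lemma newton_pair_map (B C : algType K) (f : {lrmorphism B -> C}) S p :
  newton_pair S p -> newton_pair (f \o S) (f \o p).
Proof.
move=> [S0 Sp]; split=> [|n n0] /=; first by rewrite S0 rmorph1.
rewrite -linearZ Sp // raddf_sum; apply: eq_bigr => k _; exact: rmorphM.
Qed.

(** The summand [k = n] of the recursion is [p n], because [S 0 = 1]. *)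
Lemma newton_pair_inj (B : algType K) (S T p q : nat -> B) :
  newton_pair S p -> newton_pair T q -> S =1 T ->
  forall k, (0 < k)%N -> p k = q k.
Proof.
move=> [S0 Sp] [T0 Tq] ST k; elim/ltn_ind: k => k IH k0.
have := Sp k k0; rewrite ST Tq // !big_nat_recr //= subnn S0 T0 !mul1r.
rewrite (eq_big_nat _ _ (F2 := fun j => S (k - j)%N * p j)) => [/addrI->//|j /andP[j0 jk]].
by rewrite ST IH.
Qed.

Lemma newton_pair_det (B : algType K) (S T p q : nat -> B) :
  [pchar K] =i pred0 -> newton_pair S p -> newton_pair T q ->
  (forall k, (0 < k)%N -> p k = q k) -> S =1 T.
Proof.
move=> /pcharf0P K0 [S0 Sp] [T0 Tq] pq n; elim/ltn_ind: n => -[|n] IH; first by rewrite S0.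
have n0 : n.+1%:R != 0 :> K by rewrite K0.
apply: (scalerI n0); rewrite Sp // Tq //; apply: eq_big_nat => k /andP[k0 kn].
by rewrite pq // IH //; lia.
Qed.

(** The solution of the recursion with right-hand side [b_k p_k], expanded in
    the words in the [p_k]: the coefficients obey a recursion in the last part. *)
Lemma newton_pair_composition (B : algType K) (p : nat -> B) (b : nat -> K)
    (f : nat -> seq nat -> K) :
  f 0%N [::] = 1 ->
  (forall n k a, (0 < k <= n)%N -> is_composition (n - k)%N a ->
     n%:R * f n (rcons a k) = b k * f (n - k)%N a) ->
  newton_pair (fun n => \sum_(a : composition n) f n a *: \prod_(k <- (a : seq nat)) p k)
              (fun k => b k *: p k).
Proof.
move=> f0 fP; split=> [|n n0].
  have c0 : is_composition 0 [::] by [].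
  rewrite (bigD1 (Composition c0)) //= f0 big_nil scale1r big1 ?addr0 // => a.
  by rewrite -val_eqE /= composition0.
rewrite (sum_composition_last (fun a => f n a *: \prod_(k <- a) p k) n0) scaler_sumr.
apply: eq_big_nat => k /andP[k0 kn]; rewrite scaler_sumr big_distrl.
apply: eq_bigr => a _; rewrite scalerA fP ?k0 //; last exact: (valP a).
by rewrite -cats1 big_cat big_seq1 /= -scalerAl -scalerAr scalerA mulrC.
Qed.

End NewtonPairs.

(** * Linear independence of the words in the power sums *)

Section PsiBasis.
Variable K : fieldType.
Hypothesis charK0 : [pchar K] =i pred0.

Lemma psi_newton : newton_pair (nsymS K) (psi K).
Proof. by split=> // n; exact: psi_rec. Qed.

(** For the reversal of [a], this is the coefficient
    [1 / (a_1 (a_1 + a_2) ... (a_1 + ... + a_l))] of [Psi^a] in [S_n]. *)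
Fixpoint inv_sums (s : seq nat) : K :=
  if s is k :: s' then (sumn s)%:R^-1 * inv_sums s' else 1.

(** Let [theta] send [S_n] to its own expansion in the [Psi_k] with each [Psi_k]
    replaced by [S_k]. The recursion then forces [theta Psi_k = S_k]. *)
Lemma exists_psi_letters :
  exists theta : {lrmorphism NSym K -> NSym K},
    forall k, (0 < k)%N -> theta (psi K k) = nsymS K k.
Proof.
have recK n k a : (0 < k <= n)%N -> is_composition (n - k)%N a ->
    n%:R * inv_sums (rev (rcons a k)) = 1 * inv_sums (rev a) :> K.
  move=> /andP[k0 kn] /andP[_ /eqP an].
  have E : (k + sumn (rev a))%N = n by rewrite sumn_rev an; lia.
  rewrite rev_rcons /= E mulrA divff //.
  by move/pcharf0P: charK0 => ->; lia.
have N := newton_pair_composition (nsymS K) (b := fun=> 1)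
  (f := fun _ a => inv_sums (rev a)) erefl recK.
have [theta thetaS] := exists_nsym_lift (fun n => \sum_(a : composition n)
  inv_sums (rev a) *: \prod_(k <- (a : seq nat)) nsymS K k).
exists theta => k k0; rewrite -[RHS]scale1r.
apply: (newton_pair_inj (newton_pair_map theta psi_newton) N _ k0) => -[|n].
  by rewrite N.1 /= rmorph1.
exact: (thetaS n.+1).
Qed.

Lemma prod_nsymS (a : seq nat) : all (fun k => 0 < k)%N a ->
  \prod_(k <- a) nsymS K k = << FMonom (map predn a) >>.
Proof.
elim: a => [|[//|k] a IH] /=.
  by rewrite big_nil -fmoneE.
move=> /IH E; rewrite big_cons E.
apply: etrans (malgM_def _ _) _; rewrite fgmulUU mulr1; congr mkmalgU.
by apply/eqP; rewrite fmP fmM fmU.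
Qed.

(** An endomorphism that sends each [Psi_k] to [S_k] sends [Psi^a] to the word [a]
    in the generators, so the coefficient at that word recovers the coefficient
    of [Psi^a]. As a letter, [S_k] is [k - 1]. *)
Lemma psi_word_inj n (c d : composition n -> K) :
  \sum_(a : composition n) c a *: psi_word K a
    = \sum_(a : composition n) d a *: psi_word K a -> c =1 d.
Proof.
have [theta thetaP] := exists_psi_letters.
have theta_word (a : composition n) :
    theta (psi_word K a) = << FMonom (map predn a) >>.
  have /andP[a0 _] := valP a.
  rewrite /psi_word rmorph_prod -prod_nsymS //; apply: eq_big_seq => k ka.
  by apply: thetaP; move/allP: a0; exact.
have coefE (e : composition n -> K) (a : composition n) :
    (theta (\sum_(a : composition n) e a *: psi_word K a))@_(FMonom (map predn a)) = e a.
  have thetaZ b : (theta (e b *: psi_word K b))@_(FMonom (map predn a)) =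
      e b * (FMonom (map predn b) == FMonom (map predn a))%:R.
    have -> : theta (e b *: psi_word K b) = e b *: << FMonom (map predn b) >>.
      by rewrite -theta_word; exact: linearZ_LR.
    by apply: etrans (mcoeffZ _ _ _) _; rewrite mcoeffU.
  transitivity (\sum_(b : composition n)
      e b * (FMonom (map predn b) == FMonom (map predn a))%:R).
    rewrite (raddf_sum theta) (raddf_sum (mcoeff (FMonom (map predn a)))).
    by apply: eq_bigr => b _; exact: thetaZ.
  rewrite (bigD1 a) //= eqxx mulr1 big1 ?addr0 // => b ba.
  case: eqP => [[ab]|_]; last by rewrite mulr0.
  case/eqP: ba; apply: val_inj => /=.
  have /andP[a0 _] := valP a; have /andP[b0 _] := valP b.
  have predK (s : seq nat) : all (fun k => 0 < k)%N s -> map succn (map predn s) = s.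
    by elim: s => //= k s IH /andP[k0 /IH->]; rewrite prednK.
  by rewrite -(predK _ a0) -ab predK.
by move=> E a; rewrite -coefE E coefE.
Qed.

End PsiBasis.

(** * Sprout sequences and power sums *)

Section Sprouts.
Variable K : fieldType.
Implicit Types (f g h : mpseries K) (m u : {cmonom nat}).

Lemma mps_sum_coef (I : Type) (r : seq I) (G : I -> mpseries K) m :
  (\sum_(i <- r) G i) m = \sum_(i <- r) G i m.
Proof. by apply: (big_morph (fun f : mpseries K => f m)). Qed.

Definition mono u : mpseries K := MPSeries (fun m => (m == u)%:R).

Definition upow (i k : nat) : {cmonom nat} :=
  mkcmonom [fsfun j in [fset i]%fset => k | 0%N].

Lemma upowE i k j : upow i k j = if j == i then k else 0%N.
Proof. by rewrite cmE fsfun_fun in_fset1. Qed.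

Lemma mdeg_upow i k : mdeg (upow i k) = k.
Proof.
rewrite (@mdegEw _ _ [fset i]%fset) ?big_seq_fset1 ?upowE ?eqxx //.
by apply/fsubsetP => j; rewrite -cmE_neq0 upowE in_fset1; case: (j == i).
Qed.

Lemma divcm_upowK i k m : (k <= m i)%N -> mmul (divcm m (upow i k)) (upow i k) = m.
Proof.
move=> km; apply/eqP/cmP => j; rewrite cmM divcmE upowE.
by case: eqP => [->|_]; lia.
Qed.

Lemma mul_mono f u d m : mmul d u = m -> (f * mono u) m = f d.
Proof.
move=> dm; have um : mmul u d = m by rewrite mulmC.
rewrite mpsME (big_fsetD1 _ (mboxP dm)) /= big_mkcond (big_fsetD1 _ (mboxP um)) /=.
rewrite dm !eqxx mulr1 [X in _ + X + _]big1_seq => [|b]; last first.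
  rewrite in_fsetD1 => /andP[_ /andP[/negPf -> _]].
  by rewrite mulr0 if_same.
rewrite addr0 [X in _ + X]big1_seq ?addr0 // => a.
rewrite in_fsetD1 => /andP[_ /andP[/eqP ad _]]; apply: big1 => b /eqP ab.
case: eqP => [bu|_]; last by rewrite mulr0.
case: ad; apply/eqP/cmP => i; move/eqP/cmP: (etrans ab (esym dm)) => /(_ i).
by rewrite bu !cmM => /addIn.
Qed.

Lemma mul_mono_ndvd f u m : (forall d, mmul d u <> m) -> (f * mono u) m = 0.
Proof.
move=> nd; rewrite mpsME big1 // => a _; rewrite big1 // => b /eqP ab /=.
by case: eqP => [bu|_]; [case: (nd a); rewrite -bu | rewrite mulr0].
Qed.

Lemma mul_mono_upow f i k m :
  (f * mono (upow i k)) m = if (k <= m i)%N then f (divcm m (upow i k)) else 0.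
Proof.
case: ifP => [km|/negP km]; first by apply: mul_mono; exact: divcm_upowK.
apply: mul_mono_ndvd => d dm; apply: km.
by rewrite -dm cmM upowE eqxx leq_addl.
Qed.

(** The coefficient of [f * g] at [m] sees only the coefficients of [g] at divisors
    of [m]; this replaces an infinite sum of monomials in [g] by a finite one. *)
Lemma mps_mul_divisors f g h m :
  (forall a b, mmul a b = m -> g b = h b) -> (f * g) m = (f * h) m.
Proof.
move=> gh; rewrite !mpsME; apply: eq_bigr => a _; apply: eq_bigr => b /eqP ab.
by rewrite (gh a b).
Qed.

(** The power sum [p_k], for [k > 0]. *)
Definition psum k : mpseries K :=
  MPSeries (fun m => \sum_(i <- finsupp m) (m == upow i k)%:R).

Lemma mul_psum f k m : (0 < k)%N ->
  (f * psum k) m =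
  \sum_(i <- finsupp m | (k <= m i)%N) f (divcm m (upow i k)).
Proof.
move=> k0; transitivity ((f * \sum_(i <- finsupp m) mono (upow i k)) m).
  apply: mps_mul_divisors => a b ab; rewrite mps_sum_coef /=.
  apply: big_fset_incl; first by rewrite -ab mdomD fsubsetUr.
  move=> i _ ib; case: eqP => // bu; case/negP: ib.
  by rewrite -cmE_neq0 bu upowE eqxx -lt0n.
rewrite mulr_sumr mps_sum_coef [RHS]big_mkcond.
by apply: eq_bigr => i _; exact: mul_mono_upow.
Qed.

(** Logarithmic differentiation of the product of the [F(x_i t)]. At a monomial
    [m] of degree [n], the right-hand side is the sum over [i] of the product of
    the [F (m j)], [j != i], times [sum_k F (m i - k) b_k = m i * F (m i)]; this
    is [sum_i m i = n] times the product of all the [F (m j)]. *)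
Lemma sprout_newton (F b : nat -> K) : F 0%N = 1 ->
  (forall e, e%:R * F e = \sum_(1 <= k < e.+1) F (e - k)%N * b k) ->
  newton_pair (sprout_series F) (fun k => b k *: psum k).
Proof.
move=> F0 Fb; split.
  apply: mpsP => m /=; rewrite mdeg_eq0; case: eqP => [->|] //.
  by rewrite mdom1 big_seq_fset0.
move=> n n0; apply: mpsP => m; rewrite mps_sum_coef mpsZE /=.
have term k : (0 < k < n.+1)%N -> (sprout_series F (n - k)%N * (b k *: psum k)) m =
   \sum_(i <- finsupp m) if (k <= m i)%N then
     if mdeg m == n then
       b k * (F (m i - k)%N * \prod_(j <- (finsupp m `\ i)%fset) F (m j))
     else 0 else 0.
  rewrite -[RHS]big_mkcond => /andP[k0 kn].
  rewrite -scalerAr mpsZE mul_psum // mulr_sumr.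
  rewrite big_seq_cond [RHS]big_seq_cond; apply: eq_bigr => i /andP[im km] /=.
  have := divcm_upowK km; set d := divcm m _ => dm.
  have -> : (mdeg d == n - k)%N = (mdeg m == n).
    by rewrite -[in RHS]dm mdegM mdeg_upow; apply/eqP/eqP; lia.
  case: ifP => _; last by rewrite mulr0.
  have dE j : d j = (m j - if j == i then k else 0)%N by rewrite divcmE upowE.
  congr (_ * _); transitivity (\prod_(j <- finsupp m) F (d j)).
    apply: big_fset_incl; first by rewrite -dm mdomD fsubsetUl.
    by move=> j _ /fsfun_dflt->.
  rewrite (big_fsetD1 i) //= dE eqxx; congr (_ * _).
  apply: eq_big_seq => j; rewrite in_fsetD1 dE => /andP[/negPf ji _].
  by rewrite ji subn0.
rewrite (eq_big_nat _ _ term) exchange_big /=; case: (mdeg m =P n) => [mn|_]; last first.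
  by rewrite mulr0 big1 // => i _; rewrite big1 // => k _; rewrite if_same.
transitivity (\sum_(i <- finsupp m) ((m i)%:R * \prod_(j <- finsupp m) F (m j))).
  by rewrite -mulr_suml -natr_sum -mn.
apply: eq_big_seq => i im; rewrite (big_fsetD1 i) //= mulrA Fb -[RHS]big_mkcond mulr_suml.
have min : (m i <= n)%N by rewrite -mn mdegE (big_fsetD1 i) //= leq_addr.
rewrite (big_nat_widen 1 (m i).+1 n.+1) //; apply: eq_bigr => k _.
by rewrite mulrA [b k * _]mulrC.
Qed.

(** The seed [1 / (1 - t)] has all its coefficients equal to [1], and so has its
    logarithmic derivative. *)
Lemma hsym_newton : newton_pair (hsym_series K) psum.
Proof.
have [e|N0 N] := @sprout_newton (fun=> 1) (fun=> 1) erefl.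
  by rewrite mulr1 mul1r sumr_const_nat subn1.
have E n : hsym_series K n = sprout_series (fun=> 1) n.
  by apply: mpsP => m /=; rewrite big1 //; case: eqP.
split=> [|n n0]; first by rewrite E.
rewrite E N //; apply: eq_bigr => k _; by rewrite E scale1r.
Qed.

Hypothesis charK0 : [pchar K] =i pred0.

(** The normalization by [(2n)!] turns [C(2n-1, 2k-1)] into the factor [k / (2k)!]
    of [b_k]. *)
Lemma binom_ratio n k : (0 < k <= n)%N ->
  n%:R * 'C((2 * n).-1, (2 * k).-1)%:R / ((2 * n)`!)%:R
    = k%:R / (((2 * k)`!)%:R * ((2 * (n - k))`!)%:R) :> K.
Proof.
move=> /andP[k0 kn]; have /pcharf0P nz := charK0.
apply/eqP; rewrite eqr_div ?mulf_neq0 ?nz -?lt0n ?fact_gt0 //.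
rewrite -!natrM; apply/eqP; congr (_%:R).
have := @bin_fact (2 * n).-1 (2 * k).-1.
have -> : ((2 * n).-1 - (2 * k).-1 = 2 * (n - k))%N by lia.
move=> /(_ _) E; have {}E := E ltac:(lia).
have fS j : (0 < j)%N -> ((2 * j)`! = 2 * j * (2 * j).-1`!)%N.
  by case: j => // j _; rewrite mulnS -factS.
rewrite (fS k) // (fS n) -?E; last lia.
by lia.
Qed.

(** The [b_k] are the coefficients of [t F'(t) / F(t)] for [F = sec(sqrt t)]. *)
Lemma sec_sqrt_log_deriv e :
  e%:R * sec_sqrt K e = \sum_(1 <= k < e.+1) sec_sqrt K (e - k) * coef_b K k.
Proof.
have [->|e0] := posnP e; first by rewrite mul0r big_geq.
rewrite /sec_sqrt euler_even_rec // natr_sum mulr_suml mulr_sumr.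
apply: eq_big_nat => k ke; rewrite /coef_b !natrM.
have -> (x c y z f : K) : x * (c * y * z / f) = x * c / f * (y * z) by ring.
rewrite binom_ratio // invfM; ring.
Qed.

Lemma sec_sqrt_newton :
  newton_pair (sprout_series (sec_sqrt K)) (fun k => coef_b K k *: psum k).
Proof. exact: sprout_newton (sec_sqrt0 K) sec_sqrt_log_deriv. Qed.

(** With [p] the [Psi_k], the first sequence is the image of the [S_n] under [phi]. *)
Lemma num_alt_record_newton (B : algType K) (p : nat -> B) :
  newton_pair
    (fun n => \sum_(a : composition n)
       ((num_alt_record n a)%:R / ((2 * n)`!)%:R) *: \prod_(k <- (a : seq nat)) p k)
    (fun k => coef_b K k *: p k).
Proof.
apply: (newton_pair_composition p (f := fun n a => (num_alt_record n a)%:R / ((2 * n)`!)%:R)).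
  by rewrite num_alt_record0 divr1.
move=> n k a kn _; rewrite num_alt_record_rcons // /coef_b !natrM.
have -> (x c y z f : K) : x * (c * y * z / f) = x * c / f * (y * z) by ring.
rewrite binom_ratio // invfM; ring.
Qed.

Lemma sprout_sequence_unique (F : nat -> K) (A : nat -> symfun K) n :
  F 0%N = 1 -> sprout_sequence F A -> (A n : mpseries K) = sprout_series F n.
Proof.
move=> F0 FA; apply: mpsP => m.
have [N1 E1] := FA n m; have [N2 E2] := sproutP F0 n m.
by rewrite (E1 (maxn N1 N2)) ?leq_maxl // -E2 ?leq_maxr.
Qed.

End Sprouts.

(** * The theorem *)

(** The commutative image is computed among all formal power series, where the
    power sums need no proof of symmetry. *)
HB.instance Definition _ (K : fieldType) :=
  GRing.RMorphism.copy (@symfun_series K) (\val : symfun K -> mpseries K).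
HB.instance Definition _ (K : fieldType) :=
  GRing.Linear.copy (@symfun_series K) (\val : symfun K -> mpseries K).

Theorem theorem1p3 (K : fieldType) (charK0 : [pchar K] =i pred0)
    (phi : {lrmorphism NSym K -> NSym K})
    (phi_psi : forall k : nat, (0 < k)%N -> phi (psi K k) = coef_b K k *: psi K k)
    (chi : {lrmorphism NSym K -> symfun K})
    (chi_S : forall k : nat, (0 < k)%N -> chi (nsymS K k) = hsym K k)
    (A : nat -> symfun K) (A_sprout : sprout_sequence (sec_sqrt K) A)
    (n : nat) (n_gt0 : (0 < n)%N) :
  [/\ ((2 * n)`!)%:R *: phi (nsymS K n)
        = \sum_(a : composition n) (num_alt_record n a)%:R *: psi_word K a,
      chi (phi (nsymS K n)) = A n
    & forall c : composition n -> K,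
        ((2 * n)`!)%:R *: phi (nsymS K n)
          = \sum_(a : composition n) c a *: psi_word K a ->
        forall a : composition n, c a = (num_alt_record n a)%:R].
Proof.
have phi_newton := newton_pair_map phi (psi_newton K).
have expansion : ((2 * n)`!)%:R *: phi (nsymS K n)
    = \sum_(a : composition n) (num_alt_record n a)%:R *: psi_word K a.
  have /= -> := newton_pair_det charK0 phi_newton
    (num_alt_record_newton charK0 (psi K)) phi_psi n.
  rewrite scaler_sumr; apply: eq_bigr => a _; rewrite scalerA mulrC divfK //.
  by move/pcharf0P: charK0 => ->; rewrite -lt0n fact_gt0.
split=> //; last by move=> c; rewrite expansion => /(psi_word_inj charK0) E a; rewrite E.
apply: val_inj; rewrite /= (sprout_sequence_unique n (sec_sqrt0 K) A_sprout).
pose ser : {lrmorphism symfun K -> mpseries K} := @symfun_series K.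
have chi_newton := newton_pair_map ser (newton_pair_map chi (psi_newton K)).
(* [chi Psi_k = p_k], because both pairs share the sequence [h_n]. *)
have chi_psi k : (0 < k)%N -> ser (chi (psi K k)) = psum K k.
  apply: (newton_pair_inj chi_newton (hsym_newton K)) => -[|j].
    by rewrite /= rmorph1; exact: esym (hsym_newton K).1.
  exact: (congr1 (@symfun_series K) (chi_S j.+1 isT)).
have := newton_pair_map ser (newton_pair_map chi phi_newton).
move=> /newton_pair_det /(_ (sec_sqrt_newton charK0)) H.
apply: (H charK0) => k k0 /=.
by rewrite phi_psi // linearZ /= chi_psi.
Qed.
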